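(* Let $K$ be a nonempty perfect Polish space. Then the sequential monotone closure $CD_\omega(K)^{\sigma m}$ of the vector lattice $CD_\omega(K)$ is not uniformly complete.
   Context: A topological space is perfect if it has no isolated points; it is Polish if it is separable and completely metrizable. $B(K)$ is the vector lattice of all bounded real-valued functions on $K$ with the pointwise order, $C_b(K)$ is the space of bounded continuous real-valued functions on $K$, and for $f,g\in B(K)$, $[f\neq g]=\{x\in K: f(x)\neq g(x)\}$. Define $$CD_\omega(K)=\{f\in B(K)\;:\;\exists g\in C_b(K)\text{ such that }[f\neq g]\text{ is at most countable}\},$$ with the pointwise order. Sequential monotone closure: let $E$ be an Archimedean vector lattice. A sublattice $Y$ of a vector lattice $Z$ is order dense if for every $0\neq x\in Z_+$ there is $y\in Y$ with $0<y\leq x$, and majorizing if for every $x\in Z$ there is $y\in Y$ with $x\leq y$. An order completion $E^\delta$ of $E$ is an order complete vector lattice (every nonempty subset bounded above has a supremum) in which $E$ is (identified with) an order dense and majorizing sublattice; it exists and is unique up to lattice isomorphism. Put $u(E)=\{x\in E^\delta : x_n\uparrow x \text{ for some sequence }(x_n)\subset E\}$, where $x_n\uparrow x$ means $(x_n)$ is increasing with supremum $x$ in $E^\delta$. The sequential monotone closure of $E$ is the sublattice $E^{\sigma m}:=u(E)-u(E)=\{x-y: x,y\in u(E)\}$ of $E^\delta$; it is unique up to lattice isomorphism. Uniform completeness: for an Archimedean vector lattice $G$ and $e\in G_+$, let $I_e=\{x\in G: |x|\leq\lambda e\text{ for some }\lambda\geq 0\}$ and $\|x\|_e=\inf\{\lambda\geq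 0: |x|\leq\lambda e\}$. $G$ is uniformly complete if $(I_e,\|\cdot\|_e)$ is complete for every $e\in G_+$. *)

(* Defs.v *)
From HB Require Import structures.
From mathcomp Require Import all_boot all_order all_algebra.
From mathcomp Require Import all_classical all_reals all_analysis.

Set Implicit Arguments.
Unset Strict Implicit.
Unset Printing Implicit Defensive.

Import Order.TTheory GRing.Theory Num.Theory.
Import numFieldNormedType.Exports.

Local Open Scope classical_set_scope.
Local Open Scope ring_scope.

(* Num.POrderedZmodule only puts a partial order and an additive group on the
   same carrier; their compatibility is part of this mixin. The binary suprema
   and infima are mixin fields because Hierarchy Builder rejects a join of
   GRing.Lmodule and Order.Lattice declared after Num.RealDomain. *)
HB.mixin Record isVectorLattice (R : realType) L
    of GRing.Lmodule R L & Num.POrderedZmodule L := {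
  vl_join : L -> L -> L ;
  vl_meet : L -> L -> L ;
  vl_leUx : forall x y z : L, (vl_join x y <= z) = (x <= z) && (y <= z) ;
  vl_lexI : forall x y z : L, (z <= vl_meet x y) = (z <= x) && (z <= y) ;
  vl_leD2r : forall z x y : L, x <= y -> x + z <= y + z ;
  vl_leZ2l : forall (a : R) (x y : L), 0 <= a -> x <= y -> a *: x <= a *: y
}.

#[short(type="vectorLatticeType")]
HB.structure Definition VectorLattice (R : realType) :=
  { L of GRing.Lmodule R L & Num.POrderedZmodule L & isVectorLattice R L }.

Section VectorLatticeNotions.
Context {R : realType} {L : vectorLatticeType R}.
Implicit Types (x y e : L) (Y G : set L).

Definition vl_abs x : L := vl_join x (- x).

Definition order_complete :=
  forall A : set L, A !=set0 -> has_ubound A -> supremums A !=set0.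

Definition order_dense Y :=
  forall x, 0 <= x -> x != 0 -> exists2 y, Y y & 0 < y <= x.

Definition majorizing Y := forall x, exists2 y, Y y & x <= y.

Definition increases_to (x_ : nat -> L) x :=
  nondecreasing_seq x_ /\ supremums (range x_) x.

(* The following notions are meant for a vector sublattice G of L, whose linear
   structure, order and modulus are those of L. *)
Definition principal_ideal G e : set L :=
  [set x | G x /\ exists2 l : R, 0 <= l & vl_abs x <= l *: e].

Definition unit_norm e x : R :=
  inf [set l : R | 0 <= l /\ vl_abs x <= l *: e].

Definition unit_norm_cauchy e (x_ : nat -> L) :=
  forall eps : R, 0 < eps -> exists N : nat, forall m n : nat,
    (N <= m)%N -> (N <= n)%N -> unit_norm e (x_ m - x_ n) < eps.

Definition uniformly_complete G :=
  forall e, G e -> 0 <= e ->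
  forall x_ : nat -> L, (forall n, principal_ideal G e (x_ n)) ->
    unit_norm_cauchy e x_ ->
    exists2 x, principal_ideal G e x &
      unit_norm e (x_ n - x) @[n --> \oo] --> (0 : R).

End VectorLatticeNotions.

Arguments order_complete {R} L.

Section OrderCompletion.
Context {R : realType} {E Z : vectorLatticeType R}.
Implicit Type i : {linear E -> Z}.

(* An order completion is determined up to isomorphism only: it is given by Z
   and the embedding i, through which E is identified with range i. *)
Record is_order_completion i : Prop := {
  completion_inj : injective i ;
  completion_join : {morph i : x y / vl_join x y} ;
  completion_meet : {morph i : x y / vl_meet x y} ;
  completion_complete : order_complete Z ;
  completion_dense : order_dense (range i) ;
  completion_majorizing : majorizing (range i)
}.

Definition upper_elements i : set Z :=
  [set x | exists x_ : nat -> E, increases_to (i \o x_) x].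

Definition seq_monotone_closure i : set Z :=
  [set z | exists x y, [/\ upper_elements i x, upper_elements i y & z = x - y]].

End OrderCompletion.

Section CDomega.
Context (R : realType) (K : topologicalType).

Definition CD_omega_set : set (K -> R) :=
  [set f | bounded_fun f /\
     exists g : K -> R,
       [/\ continuous g, bounded_fun g & countable [set x | f x != g x]]].

Let bounded_funE (f : K -> R) :
  bounded_fun f <-> exists M : R, forall x, `|f x| <= M.
Proof.
split=> [[M [_ fM]]|[M fM]].
  by exists (M + 1) => x; apply: (fM (M + 1)); rewrite ?ltrDl.
exists M; split; first exact: num_real.
by move=> y My x _; apply: le_trans (fM x) (ltW My).
Qed.

Let CD_omega_op2 (op : R -> R -> R) :
  (exists2 C : R, 0 <= C & forall x y, `|op x y| <= C * (`|x| + `|y|)) ->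
  (forall g g' : K -> R, continuous g -> continuous g' ->
     continuous (fun x => op (g x) (g' x))) ->
  forall f f', CD_omega_set f -> CD_omega_set f' ->
    CD_omega_set (fun x => op (f x) (f' x)).
Proof.
move=> [C C0 opC] opc.
have opb (f g : K -> R) : bounded_fun f -> bounded_fun g ->
    bounded_fun (fun x => op (f x) (g x)).
  move=> /bounded_funE[M fM] /bounded_funE[N gN]; apply/bounded_funE.
  exists (C * (M + N)) => x; apply: (le_trans (opC _ _)).
  by rewrite ler_wpM2l //; apply: lerD; [exact: fM|exact: gN].
move=> f f' [bf [g [cg bg fg]]] [bf' [g' [cg' bg' fg']]]; split.
  exact: opb.
exists (fun x => op (g x) (g' x)); split; [exact: opc|exact: opb|].
have fgU : countable ([set x | f x != g x] `|` [set x | f' x != g' x]).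
  by rewrite -bigcup2E; apply: bigcup_countable => [|[|[|n]] _];
    rewrite ?countable0 //; exact: countableP.
apply: sub_countable fgU; apply: subset_card_le => x /=.
case: (eqVneq (f x) (g x)) => [->|]; last by left.
case: (eqVneq (f' x) (g' x)) => [->|]; last by right.
by rewrite eqxx.
Qed.

Fact CD_omega_submod : GRing.subsemimod_closed (mem CD_omega_set).
Proof.
split; first split.
- rewrite inE; split; last first.
    exists (cst 0); split; [exact: cst_continuous| |].
      by apply/bounded_funE; exists 0 => x; rewrite /= normr0.
    by rewrite [X in countable X](_ : _ = set0)// -subset0 => x /=; rewrite eqxx.
  by apply/bounded_funE; exists 0 => x; rewrite /= normr0.
- move=> f g; rewrite !inE; apply: CD_omega_op2.
    by exists 1 => // x y; rewrite mul1r ler_normD.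
  by move=> h h' ch ch' x; apply: continuousD; [exact: ch|exact: ch'].
- move=> a f; rewrite !inE => ff; apply: (CD_omega_op2 (op := fun x _ => a * x)).
  + by exists `|a| => // x y; rewrite normrM ler_wpM2l// lerDl.
  + by move=> h _ ch _ x; apply: cvgM; [exact: cvg_cst|exact: ch].
  + exact: ff.
  + exact: ff.
Qed.

Fact CD_omega_join f g : f \in CD_omega_set -> g \in CD_omega_set ->
  (f \max g) \in CD_omega_set.
Proof.
rewrite !inE; apply: CD_omega_op2.
  exists 1 => // x y; rewrite mul1r /Order.max.
  by case: ifP => _; rewrite ?lerDl ?lerDr.
by move=> h h' ch ch' x; apply: continuous_max; [exact: ch|exact: ch'].
Qed.

Fact CD_omega_meet f g : f \in CD_omega_set -> g \in CD_omega_set ->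
  (f \min g) \in CD_omega_set.
Proof.
rewrite !inE; apply: CD_omega_op2.
  exists 1 => // x y; rewrite mul1r /Order.min.
  by case: ifP => _; rewrite ?lerDl ?lerDr.
by move=> h h' ch ch' x; apply: continuous_min; [exact: ch|exact: ch'].
Qed.

Definition CD_omega : Type := set_type CD_omega_set.

HB.instance Definition _ := SubChoice.on CD_omega.
HB.instance Definition _ := GRing.SubChoice_isSubLmodule.Build R (K -> R)
  _ CD_omega CD_omega_submod.
HB.instance Definition _ := Order.SubChoice_isSubPOrder.Build _ (K -> R)
  _ ring_display CD_omega.

Implicit Types f g h : CD_omega.

Fact CD_omega_leP f g : reflect (forall x, val f x <= val g x) (f <= g).
Proof. by rewrite -Order.le_val; exact: lefP. Qed.

Let joinCD f g : CD_omega := exist _ (val f \max val g) (CD_omega_join (valP f) (valP g)).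
Let meetCD f g : CD_omega := exist _ (val f \min val g) (CD_omega_meet (valP f) (valP g)).

Fact CD_omega_leUx f g h : (joinCD f g <= h) = (f <= h) && (g <= h).
Proof.
apply/CD_omega_leP/andP => [fgh|[/CD_omega_leP fh /CD_omega_leP gh] x].
  by split; apply/CD_omega_leP => x; have := fgh x;
    rewrite /= ge_max => /andP[].
by rewrite /= ge_max fh gh.
Qed.

Fact CD_omega_lexI f g h : (h <= meetCD f g) = (h <= f) && (h <= g).
Proof.
apply/CD_omega_leP/andP => [hfg|[/CD_omega_leP hf /CD_omega_leP hg] x].
  by split; apply/CD_omega_leP => x; have := hfg x;
    rewrite /= le_min => /andP[].
by rewrite /= le_min hf hg.
Qed.

Fact CD_omega_leD2r h f g : f <= g -> f + h <= g + h.
Proof.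
move=> /CD_omega_leP fg; apply/CD_omega_leP => x.
by rewrite !raddfD; apply: lerD (fg x) (lexx _).
Qed.

Fact CD_omega_leZ2l (a : R) f g : 0 <= a -> f <= g -> a *: f <= a *: g.
Proof.
move=> a0 /CD_omega_leP fg; apply/CD_omega_leP => x.
by rewrite !linearZ; apply: (ler_wpM2l a0 (fg x)).
Qed.

HB.instance Definition _ := isVectorLattice.Build R CD_omega
  CD_omega_leUx CD_omega_lexI CD_omega_leD2r CD_omega_leZ2l.

End CDomega.

Section Polish.
Context (R : realType) (K : topologicalType).

Record is_metric (dist : K -> K -> R) : Prop := {
  is_metric_ge0 : forall x y, 0 <= dist x y ;
  is_metric_eq0 : forall x y, dist x y = 0 <-> x = y ;
  is_metric_sym : forall x y, dist x y = dist y x ;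
  is_metric_triangle : forall x y z, dist x z <= dist x y + dist y z
}.

Definition induces_topology (dist : K -> K -> R) :=
  forall (x : K) (A : set K),
    nbhs x A <-> exists2 eps : R, 0 < eps & [set y | dist x y < eps] `<=` A.

Definition complete_dist (dist : K -> K -> R) :=
  forall u : nat -> K,
    (forall eps : R, 0 < eps -> exists N : nat, forall m n : nat,
       (N <= m)%N -> (N <= n)%N -> dist (u m) (u n) < eps) ->
    exists l : K, u @ \oo --> l.

Definition completely_metrizable :=
  exists dist : K -> K -> R,
    [/\ is_metric dist, induces_topology dist & complete_dist dist].

Definition separable := exists2 D : set K, countable D & dense D.

Definition polish := separable /\ completely_metrizable.

End Polish.

Arguments separable : clear implicits.

Definition perfect (K : topologicalType) := isolated [set: K] = set0.

(* Main.v *)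
Require Import Defs.
From mathcomp Require Import all_boot all_order all_algebra.
From mathcomp Require Import all_classical all_reals all_analysis.
From mathcomp Require Import lra.

Set Implicit Arguments.
Unset Strict Implicit.
Unset Printing Implicit Defensive.

Import Order.TTheory GRing.Theory Num.Theory.
Import numFieldNormedType.Exports.

Local Open Scope classical_set_scope.
Local Open Scope ring_scope.

(** The point masses belong to CD_omega(K), so CD_omega(K) is order dense and
    majorizing in the lattice of all bounded functions on K, which is
    therefore its order completion, with pointwise suprema. An upper element
    is thus a pointwise supremum u of an increasing sequence in CD_omega(K),
    and since every term agrees off a countable set with a continuous
    function, the restriction of u to the complement of some countable set is
    lower semicontinuous [upper_repr_lsc]. Instead of an isomorphism with the
    bounded functions, only the correspondence [upper_repr] between upper
    elements and pointwise suprema is used: it reflects the order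
    [upper_repr_le] and is additive [upper_repr_add], so that the unit norm of
    the constant function 1 becomes the uniform norm [upper_repr_abs_le].

    The task is then to find a uniform limit of differences of bounded lower
    semicontinuous functions which is not such a difference, even on the
    complement of a countable set. Inside a copy of the Cantor set in K take a
    decreasing sequence of closed sets F 0, F 1, ... such that F j \ F j.+1
    meets every neighbourhood of every point of F j in uncountably many points
    [perfect_chain]. Let f be 1/(j+1) on F j \ F j.+1 for even j, and 0
    everywhere else. Replacing f by 0 on F n changes it by at most 1/(n+1),
    and the function so obtained is a finite combination of indicators of
    closed sets, hence a difference of two functions coming from upper
    elements.

    Suppose f = u - v with u and v bounded, and lower semicontinuous on the
    complement of a countable set C. Starting at a point of level m outside C,
    move to a nearby point of level m-1 outside C. Neither u nor v drops by
    more than a chosen epsilon, while u - v changes by at least 1/(m+1), so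
    one of u and v has to grow by nearly that much, and so does u + v.
    Descending to level 0 makes u + v grow by at least half of 1/2 + ... +
    1/(m+1) [lsc_sum_climbs]; this is impossible for large m, because u + v is
    bounded and the harmonic series diverges. *)

(** * Vector lattices *)

Lemma supremums_rangeP d (T : porderType d) (f : nat -> T) (a : T) :
  supremums (range f) a <->
  (forall n, (f n <= a)%O) /\
  (forall c, (forall n, (f n <= c)%O) -> (a <= c)%O).
Proof.
split=> [[ub lb]|[ub lb]]; split.
- by move=> n; apply: ub; exists n.
- by move=> c fc; apply: lb => _ [n _ <-].
- by move=> _ [n _ <-].
- by move=> c fc; apply: lb => n; apply: fc; exists n.
Qed.

Section VectorLatticeTheory.
Context {R : realType} {L : vectorLatticeType R}.
Implicit Types x y z : L.

Lemma vl_lerD2r z x y : (x + z <= y + z) = (x <= y).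
Proof.
apply/idP/idP => [/(vl_leD2r (- z))|]; last exact: vl_leD2r.
by rewrite !addrK.
Qed.

Lemma vl_lerBlDr x y z : (x - y <= z) = (x <= z + y).
Proof. by rewrite -[LHS](vl_lerD2r y) subrK. Qed.

Lemma vl_lerBrDr x y z : (x <= y - z) = (x + z <= y).
Proof. by rewrite -[LHS](vl_lerD2r z) subrK. Qed.

Lemma vl_lerD x y z t : x <= y -> z <= t -> x + z <= y + t.
Proof.
move=> xy zt; apply: (@le_trans _ _ (y + z)); first by rewrite vl_lerD2r.
by rewrite ![y + _]addrC vl_lerD2r.
Qed.

Lemma vl_le_joinl x y : x <= vl_join x y.
Proof. by have := lexx (vl_join x y); rewrite vl_leUx => /andP[]. Qed.

Lemma vl_le_joinr x y : y <= vl_join x y.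
Proof. by have := lexx (vl_join x y); rewrite vl_leUx => /andP[]. Qed.

Lemma vl_abs_le x z : (vl_abs x <= z) = (x <= z) && (- x <= z).
Proof. exact: vl_leUx. Qed.

Lemma vl_absN x : vl_abs (- x) = vl_abs x.
Proof.
by apply: le_anti; rewrite /vl_abs opprK !vl_leUx !vl_le_joinl !vl_le_joinr.
Qed.

Lemma vl_absD x y : vl_abs (x + y) <= vl_abs x + vl_abs y.
Proof.
by rewrite vl_abs_le opprD; apply/andP; split; apply: vl_lerD;
  rewrite ?vl_le_joinl ?vl_le_joinr.
Qed.

(** The positive part of [x - y] is antitone in [y]. *)
Lemma vl_posB_le x y z : z <= y -> vl_join x y - y <= vl_join x z - z.
Proof.
move=> zy; rewrite vl_lerBlDr vl_leUx; apply/andP; split.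
  rewrite -addrA [- z + y]addrC -[leLHS]addr0; apply: vl_lerD.
    exact: vl_le_joinl.
  by rewrite vl_lerBrDr add0r.
rewrite -[leLHS]add0r; apply: vl_lerD => //.
by rewrite vl_lerBrDr add0r vl_le_joinr.
Qed.

Lemma vl_lerZ (l m : R) x : 0 <= x -> l <= m -> l *: x <= m *: x.
Proof.
move=> x0 lm; rewrite -subr_ge0 in lm; have := vl_leZ2l _ _ _ lm x0.
by rewrite scaler0 scalerBl vl_lerBrDr add0r.
Qed.

Lemma unit_norm_le x z (l : R) :
  0 <= l -> vl_abs z <= l *: x -> unit_norm x z <= l.
Proof. by move=> l0 zl; apply: ge_inf => //; exists 0 => m []. Qed.

(** The bound by m excludes the infimum of the empty set, which is 0 by
    convention and would say nothing about z. *)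
Lemma vl_abs_le_of_unit_norm x z (l m : R) :
  0 <= x -> 0 <= m -> vl_abs z <= m *: x ->
  unit_norm x z < l -> vl_abs z <= l *: x.
Proof.
move=> x0 m0 zm /inf_lt[|k [k0 zk] kl]; first by exists m.
by apply: le_trans zk _; apply: vl_lerZ => //; exact: ltW.
Qed.

End VectorLatticeTheory.

(** * Elements of CD_omega *)

Section CDomegaElements.
Context {R : realType} {K : topologicalType}.
Implicit Types f g : K -> R.

Lemma bounded_fun_le f (M : R) : (forall x, `|f x| <= M) -> bounded_fun f.
Proof.
move=> fM; exists M; split; first exact: num_real.
by move=> y My x _; apply: le_trans (fM x) (ltW My).
Qed.

Lemma CD_omega_bounded (f : CD_omega R K) :
  exists M : R, forall x, `|val f x| <= M.
Proof.
have [[M [_ fM]] _] := set_valP f.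
by exists (M + 1) => x; apply: (fM (M + 1)); rewrite ?ltrDl.
Qed.

Lemma continuous_CD_omega f (M : R) :
  continuous f -> (forall x, `|f x| <= M) -> CD_omega_set f.
Proof.
move=> cf fM; split; first exact: bounded_fun_le fM.
exists f; split => //; first exact: bounded_fun_le fM.
by rewrite [X in countable X](_ : _ = set0)// -subset0 => x /=; rewrite eqxx.
Qed.

Lemma point_mass_CD_omega (x : K) (c : R) :
  CD_omega_set (fun y => if `[< y = x >] then c else 0).
Proof.
split.
  apply: (@bounded_fun_le _ `|c|) => y.
  by case: ifP => _; rewrite ?normr0.
exists (cst 0); split.
- exact: cst_continuous.
- by apply: (@bounded_fun_le _ 0) => y; rewrite normr0.
- apply: (@sub_countable _ _ _ [set x]); last exact: finite_set_countable.
  apply: subset_card_le => y /=.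
  by case: ifPn => [/asboolP //|_]; rewrite eqxx.
Qed.

Definition point_mass x c : CD_omega R K :=
  SigSub (mem_set (point_mass_CD_omega x c)).

Lemma val_point_mass x c y :
  val (point_mass x c) y = if `[< y = x >] then c else 0.
Proof. by []. Qed.

Definition const_CD_omega c : CD_omega R K :=
  SigSub (mem_set (continuous_CD_omega (@cst_continuous _ _ c)
    (fun=> lexx `|c|))).

Lemma val_CD0 x : val (0 : CD_omega R K) x = 0.
Proof. by rewrite raddf0. Qed.

Lemma val_CDD (f g : CD_omega R K) x : val (f + g) x = val f x + val g x.
Proof. by rewrite raddfD. Qed.

Lemma val_CDZ c (f : CD_omega R K) x : val (c *: f) x = c * val f x.
Proof. by rewrite linearZ. Qed.

End CDomegaElements.


(** * Distance functions *)

Section Metric.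
Context {R : realType} {K : topologicalType} {dist : K -> K -> R}.
Hypotheses (dm : is_metric dist) (dt : induces_topology dist).

Lemma is_metric_xx x : dist x x = 0.
Proof. exact/(is_metric_eq0 dm). Qed.

Lemma induces_hausdorff : hausdorff_space K.
Proof.
move=> x y xy; apply/(is_metric_eq0 dm)/eqP.
rewrite eq_le (is_metric_ge0 dm) andbT leNgt; apply/negP => d0.
have d20 : 0 < dist x y / 2 by rewrite divr_gt0.
have bn z : nbhs z [set t | dist z t < dist x y / 2].
  by apply/dt; exists (dist x y / 2).
have [z [/= xz yz]] := xy _ _ (bn x) (bn y).
have := is_metric_triangle dm x z y; rewrite (is_metric_sym dm z y); lra.
Qed.

(** The infimum of the distances to [F] is 1-Lipschitz and vanishes exactly on
    the closed set [F]. *)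
Lemma dist_to_closed (F : set K) : closed F ->
  exists2 d : K -> R, continuous d & forall x, 0 <= d x /\ (d x = 0 <-> F x).
Proof.
move=> cF; have [->|/set0P[z0 Fz0]] := eqVneq F set0.
  exists (cst 1); first exact: cst_continuous.
  by move=> x; split=> //; split=> //= /eqP; rewrite oner_eq0.
pose d x := inf (dist x @` F).
have d_le x y : F y -> d x <= dist x y.
  move=> Fy; apply: ge_inf; last by exists y.
  by exists 0 => _ [z _ <-]; exact: is_metric_ge0.
have le_d x c : (forall y, F y -> c <= dist x y) -> c <= d x.
  move=> h; apply: lb_le_inf; first by exists (dist x z0), z0.
  by move=> _ [y Fy <-]; exact: h.
have d_lip x y : d x <= dist x y + d y.
  rewrite addrC -lerBlDr; apply: le_d => z Fz; rewrite lerBlDr addrC.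
  exact: le_trans (d_le x z Fz) (is_metric_triangle dm x y z).
exists d => [x|x].
  apply/cvgrPdist_lt => eps eps0; apply/dt; exists eps => // y /= xy.
  apply: le_lt_trans xy; rewrite ler_norml.
  have := d_lip x y; have := d_lip y x; rewrite (is_metric_sym dm y x); lra.
split; first by apply: le_d => y _; exact: is_metric_ge0.
split=> [d0|Fx]; last first.
  apply/eqP; rewrite eq_le -{1}(is_metric_xx x) d_le //=.
  by apply: le_d => y _; exact: is_metric_ge0.
apply: contrapT => Fx; have : nbhs x (~` F).
  by apply: open_nbhs_nbhs; split => //; exact: closed_openC.
move=> /dt[eps eps0 epsF]; have : eps <= d x.
  by apply: le_d => y Fy; rewrite leNgt; apply/negP => /epsF.
by rewrite d0 leNgt eps0.
Qed.
End Metric.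

(** * Upper elements as pointwise suprema *)

Lemma completion_le (R : realType) (E Z : vectorLatticeType R)
    (i : {linear E -> Z}) (ci : is_order_completion i) x y :
  (i x <= i y) = (x <= y).
Proof.
have joinE (L : vectorLatticeType R) (a b : L) :
    (a <= b) = (vl_join a b == b).
  by rewrite eq_le vl_leUx lexx andbT vl_le_joinr andbT.
rewrite !joinE -(completion_join ci).
by apply/eqP/eqP => [|->//]; exact: completion_inj.
Qed.

Section Representation.
Context {R : realType} {K : topologicalType} {Z : vectorLatticeType R}.
Context {i : {linear CD_omega R K -> Z}} (ci : is_order_completion i).
Implicit Types (a b : Z) (u v f g : K -> R).

(** [u] is the bounded function that an isomorphism of [Z] with the lattice of
    all bounded functions would assign to the upper element [a]. *)
Definition upper_repr a u :=
  exists2 u_ : nat -> CD_omega R K, increases_to (i \o u_) a &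
    forall x, supremums (range (fun n => val (u_ n) x)) (u x).

(** Point masses detect both implications. If some [u_ k x] exceeded [v x], a
    point mass at [x] could be added to every [v_ l] below [b], so [b] would not
    be their least upper bound. Conversely, if [i (u_ k)] were not below [b], by
    order density some nonzero [i h] would lie below the positive part of
    [i (u_ k) - b], and [v] would be strictly below [u_ k] where [h] is
    positive. *)
Lemma upper_repr_le a b u v : upper_repr a u -> upper_repr b v ->
  a <= b <-> forall x, u x <= v x.
Proof.
move=> [u_ [_ /supremums_rangeP[ua la]] usup].
move=> [v_ [_ /supremums_rangeP[vb lb]] vsup].
split.
  move=> ab x; have /supremums_rangeP[uu lu] := usup x; apply: lu => k.
  have /supremums_rangeP[vv _] := vsup x.
  rewrite leNgt; apply/negP => vu.
  (* v_ l + d stays below the join of u_ k and v_ l, hence below b. *)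
  pose d := point_mass x (val (u_ k) x - v x).
  have : b <= b - i d.
    apply: lb => l; rewrite vl_lerBrDr /= -linearD.
    apply: (@le_trans _ _ (vl_join (i (u_ k)) (i (v_ l)))); last first.
      by rewrite vl_leUx (le_trans (ua k) ab) vb.
    rewrite -(completion_join ci) (completion_le ci).
    apply/CD_omega_leP => y; rewrite val_CDD val_point_mass /= le_max.
    case: ifPn => [/asboolP ->|_]; last by rewrite addr0 lexx orbT.
    by have /= := vv l; clear ab => vvl; apply/orP; left; lra.
  rewrite vl_lerBrDr -{2}[b]add0r addrC vl_lerD2r -(linear0 i).
  rewrite (completion_le ci).
  move=> /CD_omega_leP /(_ x); rewrite val_point_mass.
  by rewrite val_CD0 asboolT // subr_le0 leNgt vu.
move=> uv.
apply: la => k /=; have [wE|wn0] := eqVneq (vl_join (i (u_ k)) b - b) 0.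
  by rewrite -(subr0_eq wE) vl_le_joinl.
have w0 : 0 <= vl_join (i (u_ k)) b - b.
  by rewrite vl_lerBrDr add0r vl_le_joinr.
have [_ [h _ <-] /andP[h0 hw]] := completion_dense ci w0 wn0.
have hge0 x : 0 <= val h x.
  have := ltW h0; rewrite -{1}(linear0 i) (completion_le ci).
  by move=> /CD_omega_leP /(_ x); rewrite val_CD0.
have [x hx] : exists x, 0 < val h x.
  apply: contrapT => /forallNP hN; have : i h <= 0.
    rewrite -(linear0 i) (completion_le ci); apply/CD_omega_leP => x.
    by rewrite val_CD0 leNgt; apply/negP.
  by move=> /(lt_le_trans h0); rewrite ltxx.
have /supremums_rangeP[/(_ k) uu _] := usup x.
suff vx : v x <= val (u_ k) x - val h x.
  by have uvx := uv x; exfalso; clear wn0 w0 h0 hw; lra.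
have /supremums_rangeP[_ lv] := vsup x; apply: lv => l /=.
have : i h <= vl_join (i (u_ k)) (i (v_ l)) - i (v_ l).
  by apply: le_trans hw _; apply: vl_posB_le; exact: vb.
rewrite vl_lerBrDr -(completion_join ci) -linearD (completion_le ci).
move=> /CD_omega_leP /(_ x); rewrite val_CDD /= le_max.
by clear wn0 w0 h0 hw; move: hx => /= hx; case/orP; lra.
Qed.

Lemma upper_repr_add a b u v : upper_repr a u -> upper_repr b v ->
  upper_repr (a + b) (fun x => u x + v x).
Proof.
move=> [u_ [und /supremums_rangeP[ua la]] usup].
move=> [v_ [vnd /supremums_rangeP[vb lb]] vsup].
have undE m n x : (m <= n)%N -> val (u_ m) x <= val (u_ n) x.
  move=> mn; have /= := und _ _ mn; rewrite (completion_le ci).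
  by move=> /CD_omega_leP; exact.
have vndE m n x : (m <= n)%N -> val (v_ m) x <= val (v_ n) x.
  move=> mn; have /= := vnd _ _ mn; rewrite (completion_le ci).
  by move=> /CD_omega_leP; exact.
exists (fun n => u_ n + v_ n).
  split; first by move=> m n mn /=; rewrite !linearD; apply: vl_lerD;
    [exact: und|exact: vnd].
  apply/supremums_rangeP; split => /= [n|c uvc].
    by rewrite linearD; apply: vl_lerD; [exact: ua|exact: vb].
  rewrite -vl_lerBrDr; apply: la => k; rewrite vl_lerBrDr addrC -vl_lerBrDr.
  apply: lb => l; rewrite vl_lerBrDr addrC.
  apply: le_trans (uvc (maxn k l)); rewrite linearD; apply: vl_lerD.
    by apply: und; rewrite leq_maxl.
  by apply: vnd; rewrite leq_maxr.
move=> x; have /supremums_rangeP[uu lu] := usup x.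
have /supremums_rangeP[vv lv] := vsup x.
apply/supremums_rangeP; split => [n|c uvc]; first by rewrite val_CDD lerD.
rewrite -lerBrDr; apply: lu => k; rewrite lerBrDr addrC -lerBrDr.
apply: lv => l; rewrite lerBrDr addrC.
apply: le_trans (uvc (maxn k l)); rewrite val_CDD; apply: lerD.
  by apply: undE; rewrite leq_maxl.
by apply: vndE; rewrite leq_maxr.
Qed.

Lemma upper_repr_incl h : upper_repr (i h) (val h).
Proof.
exists (fun=> h); last first.
  by move=> x; apply/supremums_rangeP; split => [n|c /(_ 0%N)].
by split => //; apply/supremums_rangeP; split => [n|c /(_ 0%N)].
Qed.

Lemma upper_repr_exists (u_ : nat -> CD_omega R K) u (M : R) :
  nondecreasing_seq u_ -> (forall n x, val (u_ n) x <= M) ->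
  (forall x, supremums (range (fun n => val (u_ n) x)) (u x)) ->
  exists a, upper_repr a u.
Proof.
move=> und uM usup.
have [||a asup] := completion_complete ci (A := range (i \o u_)).
- by exists (i (u_ 0%N)), 0%N.
- exists (i (const_CD_omega M)) => _ [n _ <-] /=; rewrite (completion_le ci).
  by apply/CD_omega_leP => x; exact: uM.
- exists a, u_ => //; split => // m n mn /=.
  by rewrite (completion_le ci); exact: und.
Qed.

Lemma upper_elements_repr a : upper_elements i a -> exists u, upper_repr a u.
Proof.
move=> [u_ ua].
exists (fun x => sup (range (fun n => val (u_ n) x))), u_ => // x.
have [_ [h0 _ <-] ah] := completion_majorizing ci a.
have ub : has_sup (range (fun n => val (u_ n) x)).
  split; first by exists (val (u_ 0%N) x), 0%N.
  exists (val h0 x) => _ [n _ <-].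
  have : i (u_ n) <= i h0.
    apply: le_trans ah; have [_ /supremums_rangeP[/(_ n) //]] := ua.
  by rewrite (completion_le ci) => /CD_omega_leP; exact.
split; first exact: sup_upper_bound.
by move=> c cub; apply: ge_sup => //; case: ub.
Qed.

Lemma upper_repr_bounded a u :
  upper_repr a u -> exists M, forall x, `|u x| <= M.
Proof.
move=> au; have [_ [h _ <-] ah] := completion_majorizing ci a.
have [M1 hM] := CD_omega_bounded h.
have := au => -[u_ [_ _] usup]; have [M2 uM] := CD_omega_bounded (u_ 0%N).
exists (Num.max M1 M2) => x.
have uh : u x <= val h x.
  by move: x; apply/(upper_repr_le au (upper_repr_incl h)).
have /supremums_rangeP[/(_ 0%N) uu _] := usup x.
by move: (hM x) (uM x); clear ah; rewrite le_max !ler_norml; lra.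
Qed.

Local Notation e := (i (const_CD_omega 1)).

Lemma scale_const_CD_omega (l : R) : l *: e = i (const_CD_omega l).
Proof.
rewrite -linearZ; congr (i _); apply: val_inj; apply/funext => x.
by rewrite val_CDZ /= mulr1.
Qed.

(** Moving the subtracted elements to the other side turns this into
    inequalities between upper elements, where [upper_repr_le] applies. *)
Lemma upper_repr_abs_le a b c d u v p q (l : R) :
  upper_repr a u -> upper_repr b v -> upper_repr c p -> upper_repr d q ->
  vl_abs ((a - b) - (c - d)) <= l *: e <->
  forall x, `|(u x - v x) - (p x - q x)| <= l.
Proof.
move=> au bv cp dq.
have ll : upper_repr (i (const_CD_omega l))
    (val (const_CD_omega l : CD_omega R K)) by exact: upper_repr_incl.
have ad := upper_repr_add au dq; have bc := upper_repr_add bv cp.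
have lad := upper_repr_add ll ad; have lbc := upper_repr_add ll bc.
have E1 : a - b - (c - d) = a + d - (b + c) by rewrite opprB addrACA opprD.
rewrite scale_const_CD_omega vl_abs_le E1 opprB !vl_lerBlDr.
split=> [/andP[/(upper_repr_le ad lbc) h1 /(upper_repr_le bc lad) h2] x|h].
  by have /= := h1 x; have /= := h2 x; rewrite ler_norml; clear; lra.
by apply/andP; split;
  [apply/(upper_repr_le ad lbc)|apply/(upper_repr_le bc lad)] => x /=;
  have := h x; rewrite ler_norml; clear; lra.
Qed.

(** Completeness is applied to the ideal generated by the constant function 1,
    whose norm is the uniform norm of functions. *)
Lemma uniform_limit_of_uniformly_complete (a_ b_ : nat -> Z)
    (p q : nat -> K -> R) :
  uniformly_complete (seq_monotone_closure i) ->
  (forall n, upper_repr (a_ n) (p n)) -> (forall n, upper_repr (b_ n) (q n)) ->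
  (forall eps : R, 0 < eps -> exists N, forall m n, (N <= m)%N -> (N <= n)%N ->
     forall x, `|(p m x - q m x) - (p n x - q n x)| <= eps) ->
  exists a b u v, [/\ upper_repr a u, upper_repr b v &
    forall eps : R, 0 < eps -> exists N, forall n, (N <= n)%N ->
     forall x, `|(p n x - q n x) - (u x - v x)| <= eps].
Proof.
move=> uc ap bq cauchy.
have upperP a u : upper_repr a u -> upper_elements i a.
  by move=> [u_ ? _]; exists u_.
have e0 : 0 <= e.
  rewrite -(linear0 i) (completion_le ci); apply/CD_omega_leP => x.
  by rewrite val_CD0 /= ler01.
have ge : seq_monotone_closure i e.
  exists e, (i 0); split; last by rewrite linear0 subr0.
    exact: upperP (upper_repr_incl _).
  exact: upperP (upper_repr_incl _).
pose z n := a_ n - b_ n.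
have zI n : principal_ideal (seq_monotone_closure i) e (z n).
  split.
    by exists (a_ n), (b_ n); split;
      [exact: upperP (ap n)|exact: upperP (bq n)|].
  have [M pM] := upper_repr_bounded (ap n).
  have [N qN] := upper_repr_bounded (bq n).
  exists (`|M| + `|N|); first by rewrite addr_ge0.
  have r0 : upper_repr (i 0) (val (0 : CD_omega R K)) by exact: upper_repr_incl.
  rewrite -[z n]subr0 -[X in _ - X](subrr (i 0)).
  apply/(upper_repr_abs_le _ (ap n) (bq n) r0 r0) => x.
  rewrite subrr subr0 (le_trans (ler_normB _ _))//; apply: lerD.
    by apply: le_trans (pM x) _; exact: ler_norm.
  by apply: le_trans (qN x) _; exact: ler_norm.
have zC : unit_norm_cauchy e z.
  move=> eps eps0; have eps20 : 0 < eps / 2 by rewrite divr_gt0.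
  have [N hN] := cauchy _ eps20; exists N => m n Nm Nn.
  apply: (@le_lt_trans _ _ (eps / 2)); last first.
    by rewrite ltr_pdivrMr // mulr2n mulrDr mulr1 ltrDl.
  apply: unit_norm_le; first exact: ltW.
  by apply/(upper_repr_abs_le _ (ap m) (bq m) (ap n) (bq n)); exact: hN.
have [y [[a [b [aU bU yE]]]] [ly ly0 yl] zy] := uc e ge e0 z zI zC.
have [u au] := upper_elements_repr aU; have [v bv] := upper_elements_repr bU.
exists a, b, u, v; split => // eps eps0.
have /cvgr_dist_lt/(_ _ eps0) [N _ hN] := zy.
exists N => n /hN; rewrite sub0r normrN => /(le_lt_trans (ler_norm _)) nlt.
apply/(upper_repr_abs_le _ (ap n) (bq n) au bv); rewrite -yE -/(z n).
have [_ [lz lz0 zl]] := zI n.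
apply: (vl_abs_le_of_unit_norm e0 (addr_ge0 lz0 ly0)) => //.
by rewrite scalerDl (le_trans (vl_absD _ _))// vl_absN vl_lerD.
Qed.

Definition lsc_off (C : set K) u :=
  forall x, ~ C x -> forall eps : R, 0 < eps ->
  nbhs x [set y | C y \/ u x - eps < u y].

Lemma lsc_offS (C D : set K) u : C `<=` D -> lsc_off C u -> lsc_off D u.
Proof.
move=> CD lu x Dx eps eps0; have Cx : ~ C x by move=> /CD.
by apply: filterS (lu x Cx eps eps0) => y [/CD|]; [left|right].
Qed.

(** Off the countable set where some term differs from its continuous
    companion, [u] is the supremum of the continuous companions. *)
Lemma upper_repr_lsc a u :
  upper_repr a u -> exists2 C, countable C & lsc_off C u.
Proof.
move=> [u_ _ usup].
have gE n : exists g, continuous g /\ countable [set x | val (u_ n) x != g x].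
  by have [_ [g [cg _ ug]]] := set_valP (u_ n); exists g.
pose g n := projT1 (cid (gE n)).
pose C := \bigcup_n [set x | val (u_ n) x != g n x].
exists C.
  by apply: bigcup_countable => // n _; rewrite /g; case: cid => ? [].
have ugE n y : ~ C y -> val (u_ n) y = g n y.
  by move=> Cy; apply: contra_notP Cy => /eqP; exists n.
move=> x Cx eps eps0.
have [k uk] : exists k, u x - eps < val (u_ k) x.
  apply: contrapT => /forallNP h; have /supremums_rangeP[_ lu] := usup x.
  have : u x <= u x - eps by apply: lu => n; rewrite leNgt; apply/negP.
  by rewrite lerBrDr gerDl leNgt eps0.
have cg : continuous (g k) by rewrite /g; case: cid => ? [].
rewrite ugE // in uk.
have /cvgr_gt /(_ _ uk) := cg x; apply: filterS => y /= gy.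
have [Cy|Cy] := pselect (C y); [by left|right].
apply: lt_le_trans gy _; rewrite -ugE //.
by have /supremums_rangeP[/(_ k)] := usup y.
Qed.

(** [c] off the closed set [F] is the supremum of [c * min(1, n d)], where [d]
    is the distance to [F]. *)
Lemma upper_repr_closed_compl (dist : K -> K -> R) (F : set K) (c : R) :
  is_metric dist -> induces_topology dist -> closed F -> 0 <= c ->
  exists a, upper_repr a (fun x => if `[< F x >] then 0 else c).
Proof.
move=> dm dt cF c0; have [d cd dP] := dist_to_closed dm dt cF.
pose h (n : nat) x := c * Num.min 1 (n%:R * d x).
have d0 x : 0 <= d x by case: (dP x).
have h0 n x : 0 <= h n x by rewrite mulr_ge0 // le_min ler01 mulr_ge0.
have hc n x : h n x <= c by rewrite ler_piMr // ge_min lexx.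
have hE n : CD_omega_set (h n).
  apply: (@continuous_CD_omega _ _ _ c) => [x|x]; last by rewrite ger0_norm.
  apply: cvgM; first exact: cvg_cst.
  apply: (@continuous_min _ _ (cst 1) (fun x => n%:R * d x)).
    exact: cst_continuous.
  by apply: cvgM; [exact: cvg_cst|exact: cd].
pose h_ n : CD_omega R K := SigSub (mem_set (hE n)).
apply: (upper_repr_exists (u_ := h_) (M := c)) => //.
  move=> m n mn; apply/CD_omega_leP => x /=; apply: ler_wpM2l => //.
  by apply: le_min2 => //; rewrite ler_wpM2r // ler_nat.
move=> x; apply/supremums_rangeP; have [_ dF] := dP x.
case: asboolP => Fx /=; split.
- by move=> n; rewrite /h (dF.2 Fx) mulr0 minEle ler10 mulr0.
- by move=> b /(_ 0%N); apply: le_trans; exact: h0.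
- by move=> n; exact: hc.
- have dx : 0 < d x by rewrite lt_neqAle d0 andbT eq_sym; apply/eqP => /dF.
  move=> b /(_ (Num.bound (d x)^-1)); apply: le_trans.
  rewrite /h min_l ?mulr1 // -ler_pdivrMr // div1r ltW //.
  by apply: archi_boundP; rewrite invr_ge0.
Qed.

Lemma upper_repr_sum (f : nat -> K -> R) (n : nat) :
  (forall j, exists a, upper_repr a (f j)) ->
  exists a, upper_repr a (fun x => \sum_(j < n) f j x).
Proof.
move=> fr; elim: n => [|n [a ar]].
  exists (i 0); rewrite (_ : (fun x => _) = val (0 : CD_omega R K)).
    exact: upper_repr_incl.
  by apply/funext => x; rewrite big_ord0 val_CD0.
have [b br] := fr n; exists (a + b).
rewrite (_ : (fun x => _) = (fun x => \sum_(j < n) f j x + f n x)).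
  exact: upper_repr_add.
by apply/funext => x; rewrite big_ord_recr.
Qed.

End Representation.

Arguments upper_repr {R K Z} i a u.

(** * A Cantor set in a perfect complete metric space *)

Section CantorScheme.
Context {R : realType} {K : topologicalType} {dist : K -> K -> R}.
Hypotheses (dm : is_metric dist) (dt : induces_topology dist).
Hypothesis dc : complete_dist dist.
Hypothesis K_perfect : perfect K.

Lemma perfect_near (x : K) (eps : R) : 0 < eps -> exists y, 0 < dist x y < eps.
Proof.
move=> eps0; apply: contrapT => /forallNP h.
suff : isolated [set: K] x by rewrite K_perfect.
split; first by rewrite inE.
exists [set y | dist x y < eps]; first by apply/dt; exists eps.
rewrite setIT; apply/seteqP; split => [y /= xy|_ ->/=]; last first.
  by rewrite is_metric_xx.
have [//|xNy] := pselect (y = x); exfalso; apply: (h y); rewrite xy andbT.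
rewrite lt_neqAle (is_metric_ge0 dm) andbT eq_sym.
by apply/eqP => /(is_metric_eq0 dm) /esym.
Qed.

Definition sibling (x : K) (r : R) : K := xget x [set y | 0 < dist x y < r / 2].

Lemma siblingP x r : 0 < r -> 0 < dist x (sibling x r) < r / 2.
Proof.
move=> r0; have r20 : 0 < r / 2 by rewrite divr_gt0.
exact: (xgetPex x (perfect_near x r20)).
Qed.

(** The closed ball attached to the first [n] bits of [t], as centre and radius.
    With radius a quarter of the distance between the two candidate centres, the
    two child balls are disjoint, and both lie in the parent ball because that
    distance is less than half the parent radius. *)
Fixpoint node (p0 : K) (t : nat -> bool) (n : nat) : K * R :=
  if n is m.+1 then
    let: (p, r) := node p0 t m in
    (if t m then sibling p r else p, dist p (sibling p r) / 4)
  else (p0, 1).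

Variable p0 : K.
Implicit Types t : nat -> bool.
Local Notation ctr t n := (node p0 t n).1.
Local Notation rad t n := (node p0 t n).2.

Lemma node_prefix t t' n : (forall m, (m < n)%N -> t m = t' m) ->
  node p0 t n = node p0 t' n.
Proof.
elim: n => //= n IH tt'; rewrite IH => [|m mn]; first by rewrite tt'.
by apply: tt'; rewrite ltnS ltnW.
Qed.

Lemma rad_gt0 t n : 0 < rad t n.
Proof.
elim: n => //= n; case: node => p r /= /(siblingP p)/andP[? _].
by rewrite divr_gt0.
Qed.

Lemma node_step t n :
  dist (ctr t n) (ctr t n.+1) + rad t n.+1 <= rad t n /\
  rad t n.+1 <= rad t n / 2.
Proof.
have /= := rad_gt0 t n; case: node => p r /= r0.
have /andP[] := siblingP p r0; set q := sibling p r.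
by case: ifP => _; rewrite ?is_metric_xx //; lra.
Qed.

Lemma node_nested t n k :
  dist (ctr t n) (ctr t (n + k)) + rad t (n + k) <= rad t n.
Proof.
elim: k => [|k IH]; first by rewrite addn0 is_metric_xx // add0r.
have [+ _] := node_step t (n + k); rewrite addnS.
have := is_metric_triangle dm (ctr t n) (ctr t (n + k)) (ctr t (n + k).+1).
lra.
Qed.

Lemma rad_small t (eps : R) : 0 < eps -> exists n, rad t n < eps.
Proof.
move=> eps0.
(* Halving beats the harmonic rate, as (n+2)/2 <= n+1. *)
have rn n : rad t n * n.+1%:R <= 1.
  elim: n => [|n IH]; first by rewrite /= mulr1.
  have [_ h] := node_step t n; have r0 := rad_gt0 t n.
  apply: le_trans IH; apply: (@le_trans _ _ (rad t n / 2 * n.+2%:R)).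
    by rewrite ler_wpM2r.
  rewrite -mulrA ler_wpM2l ?(ltW r0) //.
  rewrite mulrC ler_pdivrMr // -natrM ler_nat.
  by rewrite mulSn muln2 -addnn addSnnS leq_addr.
pose N := Num.bound eps^-1.
exists N; rewrite -[ltRHS]mul1r -ltr_pdivrMr //.
apply: lt_le_trans (rn N); rewrite ltr_pM2l ?rad_gt0 //.
have : eps^-1 < N%:R by apply: archi_boundP; rewrite invr_ge0 ltW.
by move=> /lt_le_trans; apply; rewrite ler_nat.
Qed.

Lemma branch_limit t : exists x, forall n, dist (ctr t n) x <= rad t n.
Proof.
have [|x ux] := dc (u := fun n => ctr t n).
  move=> eps eps0; have [N rN] := rad_small t (divr_gt0 eps0 (ltr0n R 2)).
  exists N => m n /subnKC <- /subnKC <-.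
  have := node_nested t N (m - N); have := node_nested t N (n - N).
  have := rad_gt0 t (N + (m - N)); have := rad_gt0 t (N + (n - N)).
  have := is_metric_triangle dm
    (ctr t (N + (m - N))) (ctr t N) (ctr t (N + (n - N))).
  rewrite (is_metric_sym dm _ (ctr t N)); lra.
exists x => n; apply/ler_addgt0Pr => eps eps0.
have /ux [N _ hN] : nbhs x [set y | dist x y < eps] by apply/dt; exists eps.
have /= := hN (n + N)%N (leq_addl _ _); have := node_nested t n N.
have := rad_gt0 t (n + N).
have := is_metric_triangle dm (ctr t n) (ctr t (n + N)) x.
rewrite (is_metric_sym dm (ctr t (n + N)) x); lra.
Qed.

Definition branch t : K := projT1 (cid (branch_limit t)).

Lemma branchP t n : dist (ctr t n) (branch t) <= rad t n.
Proof. by rewrite /branch; case: cid. Qed.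

Lemma branch_separated t t' n : (forall m, (m < n)%N -> t m = t' m) ->
  t n -> ~~ t' n -> branch t <> branch t'.
Proof.
move=> tt' tn t'n bE.
have := branchP t n.+1; have := branchP t' n.+1; have := rad_gt0 t n.
rewrite bE /= (node_prefix tt') tn (negbTE t'n); case: node => p r /= r0.
have /andP[] := siblingP p r0; set q := sibling p r.
have := is_metric_triangle dm p (branch t') q.
rewrite (is_metric_sym dm (branch t') q); lra.
Qed.

Lemma branch_inj : injective branch.
Proof.
move=> t t' bt; apply/funext => n.
elim/ltn_ind: n => n IH.
case tn: (t n); case t'n: (t' n) => //; exfalso.
  by apply: (branch_separated IH _ _ bt); rewrite ?tn ?t'n.
by apply: (branch_separated (t := t') _ _ _ (esym bt));
  rewrite ?tn ?t'n // => m /IH.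
Qed.

Lemma branch_near t (V : set K) : nbhs (branch t) V ->
  exists n, forall t', (forall m, (m < n)%N -> t m = t' m) -> V (branch t').
Proof.
move=> /dt[eps eps0 epsV].
have [n rn] := rad_small t (divr_gt0 eps0 (ltr0n R 2)).
exists n => t' /node_prefix tt'; apply: epsV => /=.
have := branchP t n; have := branchP t' n; rewrite -tt'.
have := is_metric_triangle dm (branch t) (ctr t n) (branch t').
rewrite (is_metric_sym dm (branch t) (ctr t n)); lra.
Qed.

Lemma branch_continuous : continuous (branch : cantor_space -> K).
Proof.
move=> t V /branch_near [n nV].
have : nbhs t [set t' : cantor_space |
    forall m : 'I_n, (t' : nat -> bool) m = (t : nat -> bool) m].
  have := @filter_forall cantor_space 'I_n
    (fun m => [set t' | (t' : nat -> bool) m = (t : nat -> bool) m])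
    (nbhs t) _.
  apply => m.
  have := @proj_continuous nat (fun=> bool) (m : nat) t [set b | b = t m].
  by apply; exact: (@discrete_set1 bool).
apply: filterS => t' tt'; apply: nV => m mn.
by have := tt' (Ordinal mn).
Qed.

End CantorScheme.

(** * A decreasing chain of Cantor sets *)

(** Any decreasing chain of infinite sets of positions with infinite successive
    differences would do; positions are counted from 1 so that the multiples of
    2^j give one. *)
Definition dyadic_support (j : nat) : set (nat -> bool) :=
  [set t | forall n, t n -> (2 ^ j %| n.+1)%N].

Lemma dyadic_support_closed j : closed (dyadic_support j : set cantor_space).
Proof.
rewrite (_ : dyadic_support j =
    \bigcap_n ((fun t : cantor_space => (t : nat -> bool) n) @^-1`
       [set b : bool | b -> (2 ^ j %| n.+1)%N])); last first.
  by apply/seteqP; split => [t tj n _|t tj n]; [exact: tj|exact: (tj n)].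
apply: closed_bigI => n _.
apply: (@preimage_closed cantor_space bool); last exact: discrete_closed.
by move=> t _; exact: (@proj_continuous nat (fun=> bool) n t).
Qed.

(** After the prefix of length [N], put ones at the positions allowed by [j] but
    not by [j.+1], which makes [t'] leave the smaller set, and diagonalize
    against [C] at the positions allowed by [j.+1]. *)
Lemma dyadic_support_escape j N t (C : set (nat -> bool)) :
  countable C -> dyadic_support j t ->
  exists t', [/\ dyadic_support j t', ~ dyadic_support j.+1 t',
    forall n, (n < N)%N -> t n = t' n & ~ C t'].
Proof.
move=> /countable_injP[f finj] tj.
pose e k : nat -> bool := xget (fun=> false) [set t | C t /\ f t = k].
pose t' n := if (n < N)%N then t n else
  if (2 ^ j.+1 %| n.+1)%N then ~~ e (n.+1 %/ 2 ^ j.+1 - N.+1)%N n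
  else (2 ^ j %| n.+1)%N.
exists t'; split.
- move=> n; rewrite /t'; case: ltnP => _; first exact: tj.
  by case: ifP => // /(dvdn_trans _) h _; apply: h; rewrite dvdn_exp2l.
- move=> /(_ (2 ^ j * N.*2.+1).-1); rewrite /t'.
  have p0 : (0 < 2 ^ j * N.*2.+1)%N by rewrite muln_gt0 expn_gt0.
  have ndvd : (2 ^ j.+1 %| 2 ^ j * N.*2.+1)%N = false.
    by rewrite expnSr dvdn_pmul2l ?expn_gt0 // dvdn2 /= odd_double.
  rewrite prednK // ndvd dvdn_mulr // ifF; first by move=> /(_ isT).
  apply/negbTE; rewrite -ltnNge (leq_trans _ (leq_pmull _ _)) ?expn_gt0//.
  by rewrite ltnS -addnn leq_addr.
- by move=> n nN; rewrite /t' nN.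
(* The position n lies beyond the prefix and carries the k-th diagonal bit. *)
- move=> Ct'; pose k := f t'; pose n := (2 ^ j.+1 * (N + k).+1).-1.
  have [Ce fe] : [set t | C t /\ f t = k] (e k) by apply: xgetPex; exists t'.
  have et' : e k = t' by apply: finj => //; rewrite inE.
  have p0 : (0 < 2 ^ j.+1 * (N + k).+1)%N by rewrite muln_gt0 expn_gt0.
  have := congr1 (fun t => t n) et'; rewrite /t' /n prednK // dvdn_mulr //.
  rewrite mulKn ?expn_gt0 // subSS addKn ifF; first by case: (e k _).
  apply/negbTE; rewrite -ltnNge (leq_trans _ (leq_pmull _ _)) ?expn_gt0//.
  by rewrite ltnS leq_addr.
Qed.

(** The chain is the image of the dyadic supports under the branch map: the
    images are closed by compactness, and by injectivity of the branch map
    escaping [C] can be arranged in the Cantor space. *)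
Lemma perfect_chain (R : realType) (K : topologicalType) (x0 : K) :
  perfect K -> completely_metrizable R K ->
  exists F : nat -> set K,
  [/\ forall j, closed (F j), forall j, F j.+1 `<=` F j, forall j, F j !=set0 &
    forall j x (V C : set K), F j x -> nbhs x V -> countable C ->
      exists y, [/\ V y, (F j `\` F j.+1) y & ~ C y]].
Proof.
move=> Kp [dist [dm dt dc]].
pose phi := branch dm dt dc Kp x0.
have phic := @branch_continuous _ _ _ dm dt dc Kp x0; rewrite -/phi in phic.
have phii := @branch_inj _ _ _ dm dt dc Kp x0; rewrite -/phi in phii.
exists (fun j => phi @` dyadic_support j).
split => [j|j|j|j _ V C [t tj <-] Vt cC].
- apply: (compact_closed (induces_hausdorff dm dt)).
  apply: (@continuous_compact cantor_space).
    exact: continuous_subspaceT.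
  apply: subclosed_compact (@subsetT _ _); last exact: cantor_space_compact.
  exact: dyadic_support_closed.
- move=> _ [t tj <-]; exists t => // n /tj; apply: dvdn_trans.
  by rewrite dvdn_exp2l.
- by exists (phi (fun=> false)), (fun=> false).
- have [N NV] := branch_near Vt.
  have cpC : countable (phi @^-1` C).
    have /countable_injP[f finj] := cC; apply/countable_injP.
    exists (f \o phi) => s s'; rewrite !inE => Cs Cs' /= ss'.
    by apply: phii; apply: finj; rewrite ?inE.
  have [t' [tj' tj1' tt' Ct']] := dyadic_support_escape N cpC tj.
  exists (phi t'); split => //; first exact: NV.
  by split; [exists t'|move=> [s sj /phii st']; apply: tj1'; rewrite -st'].
Qed.

(** * Functions constant on the layers of a chain *)

Section Layers.
Context {R : realType} {K : topologicalType}.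
Variable F : nat -> set K.
Hypothesis Fdec : forall j, F j.+1 `<=` F j.
Implicit Types (u v : K -> R).

(** These values tend to 0 but have infinite total variation. *)
Definition layer_value (j : nat) : R := if odd j then 0 else harmonic j.

Lemma layer_value_ge0 j : 0 <= layer_value j.
Proof. by rewrite /layer_value; case: odd => //; exact: harmonic_ge0. Qed.

Lemma layer_value_le N j : (N <= j)%N -> layer_value j <= N.+1%:R^-1.
Proof.
move=> Nj; rewrite /layer_value; case: odd; first by rewrite invr_ge0.
by rewrite /harmonic /= lef_pV2 ?posrE// ler_nat.
Qed.

Lemma layer_value_gap j : harmonic j.+1 <= `|layer_value j - layer_value j.+1|.
Proof.
rewrite /layer_value /=; case: odd => /=.
  by rewrite sub0r normrN ler_norm.
by rewrite subr0 ger0_norm /harmonic /= ?invr_ge0// lef_pV2 ?posrE// ler_nat.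
Qed.

(** The difference [upper_part n - lower_part n] is [layer_value j] on
    [F j `\` F j.+1] for [j < n], and 0 elsewhere, when the chain decreases;
    each of the two sums is a combination, with nonnegative coefficients, of
    indicators of complements of the sets of the chain. *)
Definition upper_part (n : nat) (x : K) : R :=
  \sum_(j < n) (if `[< F j.+1 x >] then 0 else layer_value j).

Definition lower_part (n : nat) (x : K) : R :=
  \sum_(j < n) (if `[< F j x >] then 0 else layer_value j).

Lemma F_mono j k : (j <= k)%N -> F k `<=` F j.
Proof.
by move/subnKC <-; elim: (k - j)%N => [|m IH]; rewrite ?addn0// addnS
  => x /Fdec /IH.
Qed.

Lemma partial_rank n j x : (F j `\` F j.+1) x ->
  upper_part n x - lower_part n x = if (j < n)%N then layer_value j else 0.
Proof.
move=> [Fj Fj1]; rewrite /upper_part /lower_part -sumrB.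
rewrite -(big_mkord xpredT (fun i =>
  (if `[< F i.+1 x >] then 0 else layer_value i) -
  (if `[< F i x >] then 0 else layer_value i))).
rewrite (eq_bigr (fun i => if i == j then layer_value j else 0)) => [|k _].
  by rewrite -big_mkcond /= big_nat1_eq.
have [->|kj] := eqVneq k j; first by rewrite asboolF // asboolT // subr0.
have [kj'|jk|/eqP] := ltngtP k j; last by rewrite (negbTE kj).
  by rewrite !asboolT ?subrr//;
    [apply: (F_mono (ltnW kj'))|apply: (F_mono kj')].
by rewrite !asboolF ?subrr // => /F_mono h; apply: Fj1; apply: h => //;
  rewrite ltnS ltnW.
Qed.

Lemma partial_norank n x : (forall j, ~ (F j `\` F j.+1) x) ->
  upper_part n x - lower_part n x = 0.
Proof.
move=> h; rewrite /upper_part /lower_part -sumrB big1 // => k _.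
suff -> : `[< F k x >] = `[< F k.+1 x >] by rewrite subrr.
apply: asbool_equiv_eq; split => [Fk|/Fdec//].
by apply: contrapT => Fk1; exact: (h k).
Qed.

Lemma partial_cauchy N m n x : (N <= m)%N -> (N <= n)%N ->
  `|(upper_part m x - lower_part m x) - (upper_part n x - lower_part n x)|
    <= N.+1%:R^-1.
Proof.
move=> Nm Nn.
have [[j xj]|/forallNP h] := pselect (exists j, (F j `\` F j.+1) x); last first.
  by rewrite !partial_norank // subrr normr0 invr_ge0.
rewrite !(partial_rank _ xj).
have [jN|Nj] := ltnP j N.
  by rewrite (leq_trans jN Nm) (leq_trans jN Nn) subrr normr0 invr_ge0.
have := layer_value_le Nj; have := layer_value_ge0 j => j0 jl.
case: ifP => _; case: ifP => _;
  by rewrite ?subrr ?subr0 ?sub0r ?normrN ?normr0 ?ger0_norm ?invr_ge0.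
Qed.

(** Passing from level [m.+1] to level [m] loses at most a quarter of
    [harmonic m.+1] in each of [u] and [v], while their difference changes by at
    least [harmonic m.+1]; so [u + v] gains half of it. The factor 2 and the
    summand 1 account for this half and for [harmonic 0]. *)
Lemma lsc_sum_climbs u v (C : set K) :
  (forall j x (V D : set K), F j x -> nbhs x V -> countable D ->
      exists y, [/\ V y, (F j `\` F j.+1) y & ~ D y]) ->
  countable C -> lsc_off C u -> lsc_off C v ->
  (forall j x, (F j `\` F j.+1) x -> u x - v x = layer_value j) ->
  forall m x, (F m `\` F m.+1) x -> ~ C x ->
  exists y, series harmonic m.+1 <= 2 * ((u y + v y) - (u x + v x)) + 1.
Proof.
move=> Fesc cC lu lv uvj; elim=> [|m IH] x Fx Cx.
  by exists x; rewrite subrr mulr0 add0r /series /= big_nat1 /harmonic /= invr1.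
have eps0 : 0 < (harmonic m.+1 : R) / 4 by rewrite divr_gt0 // harmonic_gt0.
have nV := filterI (lu _ Cx _ eps0) (lv _ Cx _ eps0).
have [y [[/= uy vy] Fy Cy]] := Fesc _ _ _ _ (Fdec Fx.1) (nV _) cC.
have [y' hy'] := IH y Fy Cy; exists y'.
rewrite /series /= big_nat_recr //= -[X in X + _]/(series harmonic m.+1).
have := layer_value_gap m; rewrite -(uvj _ _ Fy) -(uvj _ _ Fx).
case: uy => // uy; case: vy => // vy.
rewrite ler_normr /= in eps0 *; set h : R := m.+2%:R^-1 in eps0 uy vy *.
by case/orP; lra.
Qed.

End Layers.

(** * The sequential monotone closure *)

Theorem theorem2p7 (R : realType) (K : topologicalType)
    (K_nonempty : [set: K] !=set0) (K_perfect : perfect K)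
    (K_polish : polish R K)
    (Z : vectorLatticeType R) (i : {linear CD_omega R K -> Z})
    (Z_completion : is_order_completion i) :
  ~ uniformly_complete (seq_monotone_closure i).
Proof.
move=> uc; have [x0 _] := K_nonempty; have [_ cm] := K_polish.
have [F [Fcl Fdec F0 Fesc]] := perfect_chain x0 K_perfect cm.
have [dist [dm dt _]] := cm.
have PE n : exists a, upper_repr i a (upper_part F n).
  apply: (upper_repr_sum Z_completion
    (f := fun j x => if `[< F j.+1 x >] then 0 else layer_value j)) => j.
  exact: (upper_repr_closed_compl Z_completion dm dt (Fcl _)
    (layer_value_ge0 _)).
have QE n : exists a, upper_repr i a (lower_part F n).
  apply: (upper_repr_sum Z_completion
    (f := fun j x => if `[< F j x >] then 0 else layer_value j)) => j.
  exact: (upper_repr_closed_compl Z_completion dm dt (Fcl _)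
    (layer_value_ge0 _)).
have [a_ aP] := choice PE; have [b_ bQ] := choice QE.
have [|a [b [u [v [au bv uvl]]]]] :=
  uniform_limit_of_uniformly_complete Z_completion uc aP bQ.
  move=> eps eps0; exists (Num.bound eps^-1) => m n Nm Nn x.
  apply: le_trans (partial_cauchy Fdec x Nm Nn) _.
  rewrite -[leRHS]invrK lef_pV2 ?posrE ?invr_gt0 //.
  apply: ltW; apply: (@lt_le_trans _ _ (Num.bound eps^-1)%:R); last first.
    by rewrite ler_nat.
  by apply: archi_boundP; rewrite invr_ge0 ltW.
have uvj j x : (F j `\` F j.+1) x -> u x - v x = layer_value j.
  move=> xj; apply/eqP; rewrite eq_sym -subr_eq0 -normr_le0.
  apply/ler_addgt0Pr => eps eps0.
  (* Any index beyond j puts the layer j inside the truncation. *)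
  have [N hN] := uvl _ eps0; have := hN (maxn N j.+1) (leq_maxl _ _) x.
  by rewrite (partial_rank Fdec _ xj) leq_maxr add0r.
have [Cu cCu lu] := upper_repr_lsc au.
have [Cv cCv lv] := upper_repr_lsc bv.
pose C := Cu `|` Cv.
have cC : countable C.
  by rewrite /C -bigcup2E; apply: bigcup_countable => // -[|[|n]] _ /=.
have luC : lsc_off C u by apply: lsc_offS lu => y; left.
have lvC : lsc_off C v by apply: lsc_offS lv => y; right.
have [Mu uM] := upper_repr_bounded Z_completion au.
have [Mv vM] := upper_repr_bounded Z_completion bv.
apply: (@dvg_harmonic R); apply: nondecreasing_is_cvgn.
  by apply: nondecreasing_series => n _ _; exact: harmonic_ge0.
(* The gain of u + v is at most 2 (Mu + Mv). *)
exists (4 * (Mu + Mv) + 1) => _ [m _ <-].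
have [z Fz] := F0 m.
have [x [_ Fx Cx]] := Fesc m z setT C Fz filterT cC.
have [y hy] := lsc_sum_climbs Fdec Fesc cC luC lvC uvj Fx Cx.
apply: (@le_trans _ _ (series harmonic m.+1)).
  by rewrite /series /= big_nat_recr //= lerDl harmonic_ge0.
have := uM x; have := uM y; have := vM x; have := vM y; rewrite !ler_norml.
lra.
Qed.
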